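(* Let $X\sim N_d(\theta,\sigma_X^2 I_d)$ and $Y\sim N_d(\theta,\sigma_Y^2 I_d)$ be independent, with $\theta\in\mathbb{R}^d$ unknown and $\sigma_X^2,\sigma_Y^2>0$ known, and consider the problem of estimating the density of $Y$ on the basis of $X$ under $\alpha$-divergence loss $L_\alpha$ with $|\alpha|<1$. Let $0<a<1$, $\hat\theta_a(X)=aX$, $r=\sigma_X^2/\sigma_Y^2$, and for $c\ge 1$ let $q_{\hat\theta_a,c}(\cdot;X)$ be the density of $N_d(aX,c^2\sigma_Y^2 I_d)$. Then $q_{\hat\theta_a,c}$ dominates the plug-in density $q_{\hat\theta_a,1}$ (over the parameter space $\mathbb{R}^d$) if and only if $1<c^2\le k^2(\alpha,a,r)$, where $k(\alpha,a,r)$ is the solution in $c\in(1,\infty)$ of $$2(1-\alpha)c^2-\left(4+(1-\alpha^2)a^2 r\right)c^{1-\alpha}+(1+\alpha)\left(2+(1-\alpha)a^2 r\right)=0.$$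
   Context: Let $q(\cdot|\theta)$ be the density of $N_d(\theta,\sigma_Y^2 I_d)$. For $|\alpha|<1$ let $h_\alpha(z)=\frac{4}{1-\alpha^2}\left(1-z^{(1+\alpha)/2}\right)$. The $\alpha$-divergence loss of a predictive density $\hat q(\cdot;x)$ is $L_\alpha(\theta,\hat q(\cdot;x))=\int_{\mathbb{R}^d}h_\alpha\!\left(\frac{\hat q(y;x)}{q(y|\theta)}\right)q(y|\theta)\,dy$, and its frequentist risk is $R_\alpha(\theta,\hat q)=\mathbb{E}_\theta[L_\alpha(\theta,\hat q(\cdot;X))]$, the expectation being over $X\sim N_d(\theta,\sigma_X^2I_d)$. A predictive density $\hat q_1$ dominates $\hat q_2$ if $R_\alpha(\theta,\hat q_1)\le R_\alpha(\theta,\hat q_2)$ for all $\theta$ in the parameter space, with strict inequality for at least one such $\theta$. *)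

(* Defs.v *)
From HB Require Import structures.
From mathcomp Require Import all_boot all_order all_algebra.
From mathcomp Require Import all_classical all_reals all_analysis.

Set Implicit Arguments.
Unset Strict Implicit.
Unset Printing Implicit Defensive.

Import Order.TTheory GRing.Theory Num.Theory.
Import numFieldNormedType.Exports.

Local Open Scope classical_set_scope.
Local Open Scope ring_scope.

(* Vectors of R^d are represented by [d.-tuple R], whose sigma-algebra in the
   library is the one generated by the coordinates, i.e. the Borel one. *)

Section lebesgue_tuple.
Context (R : realType).

Definition tuple_cons (d : nat) (p : measurableTypeR R * d.-tuple R) : d.+1.-tuple R :=
  [tuple of p.1 :: p.2].

Lemma measurable_tuple_cons (d : nat) :
  measurable_fun [set: measurableTypeR R * d.-tuple R] (@tuple_cons d).
Proof. exact: measurable_cons. Qed.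

(* Lebesgue measure on R^d: the d-fold product of [lebesgue_measure], carried
   to tuples along R * R^d ~ R^(d+1); R^0 has unit mass. *)
Fixpoint lebesgue_tuple (d : nat) : set (d.-tuple R) -> \bar R :=
  match d with
  | 0 => dirac [tuple]
  | d'.+1 => pushforward (lebesgue_measure \x @lebesgue_tuple d')%E
                         (@tuple_cons d')
  end.

Lemma product_sigma_finite (d1 d2 : measure_display) (T1 : measurableType d1)
    (T2 : measurableType d2) (m1 : {sigma_finite_measure set T1 -> \bar R})
    (m2 : {sigma_finite_measure set T2 -> \bar R}) :
  sigma_finite setT (m1 \x m2)%E.
Proof.
have /sigma_finiteP[F [TF ndF Foo]] := sigma_finiteT m1.
have /sigma_finiteP[G [TG ndG Goo]] := sigma_finiteT m2.
exists (fun n => F n `*` G n) => [|k].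
  rewrite -setXTT TF TG; apply/seteqP; split=> [[x y]|[x y] [n _ []/= ? ?]].
    move=> [/= [n _ Fnx] [k _ Gky]]; exists (maxn n k) => //; split.
      by move: x Fnx; exact/subsetPset/ndF/leq_maxl.
    by move: y Gky; exact/subsetPset/ndG/leq_maxr.
  by split; exists n.
have [? ?] := Foo k; have [? ?] := Goo k; split; first exact: measurableX.
by rewrite product_measure1E// lte_mul_pinfty// ge0_fin_numE.
Qed.

Lemma pushforward_tuple_cons_sigma_finite (d : nat)
    (mu : {measure set (measurableTypeR R * d.-tuple R)%type -> \bar R}) :
  sigma_finite setT mu ->
  exists nu : {sigma_finite_measure set d.+1.-tuple R -> \bar R},
    nu = pushforward mu (@tuple_cons d) :> (set _ -> \bar R).
Proof.
move=> [F TF mF].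
pose f : {mfun (measurableTypeR R * d.-tuple R)%type >-> d.+1.-tuple R} :=
  mfun_Sub (mem_set (@measurable_tuple_cons d)).
pose g (t : d.+1.-tuple R) : measurableTypeR R * d.-tuple R :=
  (thead t, [tuple of behead t]).
have mg : measurable_fun setT g.
  by apply: measurable_fun_pair; [exact: measurable_tnth|exact: measurable_behead].
have gf p : g (tuple_cons p) = p.
  by case: p => x t; congr pair; exact/val_inj.
pose m : set (d.+1.-tuple R) -> \bar R := pushforward mu f.
have m_sf : sigma_finite setT m.
  exists (fun n => g @^-1` F n) => [|n].
    by rewrite -preimage_bigcup -TF preimage_setT.
  have [mFn Foo] := mF n; split.
    by rewrite -[X in measurable X]setTI; exact: mg.
  rewrite /m /pushforward (_ : f @^-1` _ = F n)//.
  by apply/seteqP; split=> p /=; rewrite gf.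
have m0 : m set0 = 0%E by exact: measure0.
have m_ge0 A : (0 <= m A)%E by exact: measure_ge0.
have m_add : semi_sigma_additive m by exact: measure_semi_sigma_additive.
pose M := isMeasure.Build _ _ _ m m0 m_ge0 m_add.
pose MM : {measure set d.+1.-tuple R -> \bar R} := HB.pack m M.
pose S := @Measure_isSigmaFinite.Build _ _ _ MM m_sf.
pose MS : {sigma_finite_measure set d.+1.-tuple R -> \bar R} := HB.pack m M S.
by exists MS.
Qed.

Lemma lebesgue_tuple_sigma_finite_measure (d : nat) :
  exists nu : {sigma_finite_measure set d.-tuple R -> \bar R},
    nu = @lebesgue_tuple d :> (set _ -> \bar R).
Proof.
elim: d => [|d [nu IH]]; first by exists (dirac [tuple]).
have [m mE] :=
  pushforward_tuple_cons_sigma_finite (product_sigma_finite lebesgue_measure nu).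
by exists m; rewrite mE [RHS]/= -IH.
Qed.

Let lebesgue_tuple0 (d : nat) : @lebesgue_tuple d set0 = 0%E.
Proof.
by have [nu <-] := lebesgue_tuple_sigma_finite_measure d; exact: measure0.
Qed.

Let lebesgue_tuple_ge0 (d : nat) A : (0 <= @lebesgue_tuple d A)%E.
Proof.
by have [nu <-] := lebesgue_tuple_sigma_finite_measure d; exact: measure_ge0.
Qed.

Let lebesgue_tuple_sigma_additive (d : nat) :
  semi_sigma_additive (@lebesgue_tuple d).
Proof.
have [nu <-] := lebesgue_tuple_sigma_finite_measure d.
exact: measure_semi_sigma_additive.
Qed.

HB.instance Definition _ (d : nat) := isMeasure.Build _ _ _ (@lebesgue_tuple d)
  (@lebesgue_tuple0 d) (@lebesgue_tuple_ge0 d) (@lebesgue_tuple_sigma_additive d).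

Let lebesgue_tuple_sigma_finite (d : nat) :
  sigma_finite setT (@lebesgue_tuple d).
Proof.
by have [nu <-] := lebesgue_tuple_sigma_finite_measure d; exact: sigma_finiteT.
Qed.

HB.instance Definition _ (d : nat) := Measure_isSigmaFinite.Build _ _ _
  (@lebesgue_tuple d) (@lebesgue_tuple_sigma_finite d).

End lebesgue_tuple.
Arguments lebesgue_tuple {R} d.

Section normal_tuple.
Context (R : realType) (d : nat).
Implicit Types m y : d.-tuple R.

(* [v] is the common variance of the coordinates, not the standard deviation. *)
Definition normal_density m (v : R) y : R :=
  (2 * pi * v) `^ (- (d%:R / 2)) *
  expR (- (\sum_(i < d) (tnth y i - tnth m i) ^+ 2) / (2 * v)).

Definition normal_law m (v : R) (A : set (d.-tuple R)) : \bar R :=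
  (\int[lebesgue_tuple d]_(y in A) (normal_density m v y)%:E)%E.

Definition scale_tuple (a : R) (x : d.-tuple R) : d.-tuple R :=
  [tuple a * tnth x i | i < d].

End normal_tuple.

Section predictive_density.
Context (R : realType) (d : nat).

(* [qhat x] is the density estimate of the law of Y after observing X = x. *)
Definition predictive_density := d.-tuple R -> d.-tuple R -> R.

Definition h_alpha (alpha z : R) : R :=
  4 / (1 - alpha ^+ 2) * (1 - z `^ ((1 + alpha) / 2)).

(* [q theta] is the density of Y and [p] a predictive density [qhat x]. *)
Definition alpha_loss (alpha : R) (q : d.-tuple R -> d.-tuple R -> R)
    (theta : d.-tuple R) (p : d.-tuple R -> R) : \bar R :=
  (\int[lebesgue_tuple d]_y
     (h_alpha alpha (p y / q theta y) * q theta y)%:E)%E.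

Definition alpha_risk (dO : measure_display) (Omega : measurableType dO)
    (P : d.-tuple R -> probability Omega R) (X : {mfun Omega >-> d.-tuple R})
    (alpha : R) (q : d.-tuple R -> d.-tuple R -> R) (theta : d.-tuple R)
    (qhat : predictive_density) : \bar R :=
  (\int[P theta]_w alpha_loss alpha q theta (qhat (X w)))%E.

Definition dominates_on (Theta : set (d.-tuple R))
    (risk : d.-tuple R -> predictive_density -> \bar R)
    (q1 q2 : predictive_density) : Prop :=
  (forall theta, Theta theta -> (risk theta q1 <= risk theta q2)%E) /\
  (exists2 theta, Theta theta & (risk theta q1 < risk theta q2)%E).

Definition expanded_density (a sigmaY c : R) : predictive_density :=
  fun x => normal_density (scale_tuple a x) (c ^+ 2 * sigmaY ^+ 2).

End predictive_density.

Definition independent_rv (dO d1 d2 : measure_display)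
    (Omega : measurableType dO) (T1 : measurableType d1)
    (T2 : measurableType d2) (R : realType) (P : probability Omega R)
    (X : {mfun Omega >-> T1}) (Y : {mfun Omega >-> T2}) : Prop :=
  forall (A : set T1) (B : set T2), measurable A -> measurable B ->
    P (X @^-1` A `&` Y @^-1` B) = (P (X @^-1` A) * P (Y @^-1` B))%E.

Definition expansion_equation (R : realType) (alpha a r c : R) : Prop :=
  2 * (1 - alpha) * c ^+ 2
    - (4 + (1 - alpha ^+ 2) * a ^+ 2 * r) * c `^ (1 - alpha)
    + (1 + alpha) * (2 + (1 - alpha) * a ^+ 2 * r) = 0.

(* Main.v *)
Require Import Defs.
From HB Require Import structures.
From mathcomp Require Import all_boot all_order all_algebra.
From mathcomp Require Import all_classical all_reals all_analysis.
From mathcomp Require Import measurable_realfun.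
From mathcomp Require Import ring lra.

Set Implicit Arguments.
Unset Strict Implicit.
Unset Printing Implicit Defensive.

Import Order.TTheory GRing.Theory Num.Theory.
Import numFieldNormedType.Exports.

Local Open Scope classical_set_scope.
Local Open Scope ring_scope.

(** Write beta = (1 + alpha) / 2, v = sigmaY ^+ 2, u = sigmaX ^+ 2, r = u / v.

    Since beta + (1 - beta) = 1, the alpha-loss of p at q is
    4 / (1 - alpha ^+ 2) * (1 - A), where the affinity A is the integral of
    p `^ beta * q `^ (1 - beta).  For Gaussian p and q this integrand is again
    an unnormalised Gaussian, so A is explicit ([integral_gauss_affinity]): it
    is a constant times the exponential of a negative multiple of
    |a x - theta|^2.  Averaging over x drawn from N(theta, u I) is a second
    Gaussian integral of the same kind ([integral_affinity_normal]), and the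
    risk of the expansion by c at theta is therefore
      4 / (1 - alpha ^+ 2) * (1 - expR (d / 2 * L c - kappa |theta|^2 / B c)),
    where
      B c = beta + (1 - beta) c ^+ 2 + (1 - alpha ^+ 2) / 4 * a ^+ 2 * r,
      L c = (1 - alpha) * ln c - ln (B c),
    and kappa > 0 because a <> 1.  As B is increasing in c >= 1, expanding the
    plug-in density always improves the term in |theta|^2, strictly so when
    theta <> 0.  Hence domination holds for c > 1 exactly when it holds
    weakly at theta = 0, that is when L 1 <= L c, that is when
    B c <= B 1 * c `^ (1 - alpha); four times the difference of the two sides
    is the left-hand side of the equation for k ([expansion_lhsE],
    [expansion_lhs_le0]).

    It remains to see that this left-hand side is negative on ]1, k[ and
    positive beyond k for a single k > 1.  After the substitution c = expR t it
    becomes a combination of two exponentials and a constant which vanishes at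
    t = 0, first decreases, then increases, and is eventually positive
    ([expR_trinomial_sign]). *)

(** * Integration on R^d *)

(** Any density of nu agrees almost everywhere with the Radon-Nikodym
    derivative, for which the change of measure is known. *)
Lemma ge0_integral_density (disp : measure_display) (T : measurableType disp)
    (R : realType) (nu : probability T R)
    (mu : {sigma_finite_measure set T -> \bar R}) (g f : T -> R) :
  measurable_fun setT g -> (forall x, 0 <= g x) ->
  (forall A, measurable A -> nu A = (\int[mu]_(x in A) (g x)%:E)%E) ->
  measurable_fun setT f -> (forall x, 0 <= f x) ->
  (\int[nu]_x (f x)%:E = \int[mu]_x (f x * g x)%:E)%E.
Proof.
move=> mg g0 nuE mf f0.
have mEg : measurable_fun [set: T] (fun x => (g x)%:E) by exact/measurable_EFinP.
have mEf : measurable_fun [set: T] (fun x => (f x)%:E) by exact/measurable_EFinP.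
have numu : nu `<< mu.
  apply/null_content_dominatesP => A mA muA; rewrite nuE//.
  by apply: null_set_integral => //; exact: measurable_funTS.
have gint : mu.-integrable setT (EFin \o g).
  apply/integrableP; split=> //.
  under eq_integral do rewrite /= ger0_norm//.
  by rewrite -nuE// probability_setT ltry.
set h := Radon_Nikodym_SigmaFinite.f nu mu.
have hint : mu.-integrable setT h by exact: Radon_Nikodym_SigmaFinite.f_integrable.
have gh : ae_eq mu setT h (EFin \o g).
  apply: integral_ae_eq => // A _ mA.
  by rewrite -Radon_Nikodym_SigmaFinite.f_integral//; exact: nuE.
rewrite -(Radon_Nikodym_SigmaFinite.change_of_variables numu)//.
under [RHS]eq_integral do rewrite EFinM.
apply: ae_eq_integral => //.
- by apply: emeasurable_funM => //; exact: measurable_int hint.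
- exact: emeasurable_funM.
- exact: ae_eqe_mul2l.
Qed.

(** Induction on d: lebesgue_tuple is by construction an iterated product, so
    Tonelli splits off the first coordinate. *)
Lemma integral_lebesgue_tuple_prod (R : realType) (d : nat)
    (f : 'I_d -> R -> R) (I : 'I_d -> R) :
  (forall i, measurable_fun setT (f i)) -> (forall i x, 0 <= f i x) ->
  (forall i, (\int[lebesgue_measure]_x (f i x)%:E)%E = (I i)%:E) ->
  (\int[lebesgue_tuple d]_y (\prod_(i < d) f i (tnth y i))%:E)%E =
  (\prod_(i < d) I i)%:E.
Proof.
elim: d f I => [|d IH] f I mf f0 fI.
  under eq_integral do rewrite big_ord0.
  by rewrite big_ord0 integral_cst//= diracE in_setT mul1e.
have mprod n (h : 'I_n -> R -> R) : (forall i, measurable_fun setT (h i)) ->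
    measurable_fun setT (fun y : n.-tuple R => \prod_(i < n) h i (tnth y i)).
  move=> mh; apply: measurable_prod => i _.
  by apply: measurableT_comp => //; exact: measurable_tnth.
have prod0 n (h : 'I_n -> R -> R) y :
    (forall i x, 0 <= h i x) -> 0 <= \prod_(i < n) h i (tnth y i).
  by move=> h0; apply: prodr_ge0.
rewrite [LHS](@ge0_integral_pushforward _ _ _ _ _ (@tuple_cons R d)
  (@measurable_tuple_cons R d)
  (lebesgue_measure \x lebesgue_tuple d)%E setT
  (fun y => (\prod_(i < d.+1) f i (tnth y i))%:E))//; last 2 first.
- by apply/measurable_EFinP; exact: mprod.
- by move=> y _; rewrite lee_fin; exact: (prod0 _ f).
rewrite preimage_setT.
pose F (z : R * d.-tuple R) :=
  (f ord0 z.1 * \prod_(i < d) f (lift ord0 i) (tnth z.2 i))%:E.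
have consE : ((fun y => (\prod_(i < d.+1) f i (tnth y i))%:E) \o
    @tuple_cons R d) = F.
  apply/funext => -[x y]; rewrite /F /= big_ord_recl; congr (_ * _)%:E.
  by apply: eq_bigr => i _; rewrite tnthS; congr (f _ (tnth _ i)); exact/val_inj.
rewrite consE fubini_tonelli1//; last 2 first.
- apply/measurable_EFinP; apply: measurable_funM.
    by apply: measurableT_comp => //.
  by apply: (measurableT_comp (mprod _ (fun i => f (lift ord0 i)) _)) => //.
- by move=> z; rewrite lee_fin mulr_ge0//; exact: (prod0 _ (fun i => f (lift ord0 i))).
rewrite /fubini_F /F/=.
under eq_integral => x _.
  under eq_integral do rewrite EFinM.
  rewrite ge0_integralZl_EFin//; last 2 first.
  - by move=> y _; rewrite lee_fin; exact: (prod0 _ (fun i => f (lift ord0 i))).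
  - by apply/measurable_EFinP; exact: (mprod _ (fun i => f (lift ord0 i))).
  rewrite (IH (fun i => f (lift ord0 i)) (fun i => I (lift ord0 i)))//.
  rewrite muleC.
  over.
rewrite ge0_integralZl_EFin//=.
- by rewrite fI big_ord_recl mulrC EFinM.
- by move=> x _; rewrite lee_fin; exact: f0.
- by apply/measurable_EFinP; exact: mf.
- apply: prodr_ge0 => i _.
  by rewrite -lee_fin -fI integral_ge0// => x _; rewrite lee_fin; exact: f0.
Qed.

(** * Gaussian integrals *)

(** Completing the square: the integrand is proportional to the Gaussian density
    centred at the weighted mean of m and n, with variance s ^+ 2.  The loss and
    the risk are both integrals of this form. *)
Lemma integral_gauss2 (R : realType) (k l m n : R) : 0 <= k -> 0 <= l ->
  0 < k + l ->
  (\int[lebesgue_measure]_x (expR (- (k * (x - m) ^+ 2 + l * (x - n) ^+ 2)))%:E)%E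
  = (expR (2^-1 * ln (pi / (k + l)) - k * l / (k + l) * (m - n) ^+ 2))%:E.
Proof.
move=> k0 l0 kl0.
pose s := Num.sqrt ((2 * (k + l))^-1).
have s2 : s ^+ 2 = (2 * (k + l))^-1 by rewrite sqr_sqrtr// invr_ge0; lra.
have s0 : 0 < s by rewrite sqrtr_gt0 invr_gt0; lra.
have kl_neq0 : k + l != 0 by rewrite gt_eqF.
pose mu := (k * m + l * n) / (k + l).
have e x : expR (- (k * (x - m) ^+ 2 + l * (x - n) ^+ 2)) =
    expR (2^-1 * ln (pi / (k + l)) - k * l / (k + l) * (m - n) ^+ 2) *
    normal_pdf mu s x.
  rewrite normal_pdfE ?gt_eqF//.
  have -> : normal_peak s = expR (- (2^-1 * ln (pi / (k + l)))).
    rewrite /normal_peak s2 expRN; congr (_^-1).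
    rewrite [2^-1 * _]mulrC expRM lnK ?posrE ?divr_gt0 ?pi_gt0// powR12_sqrt; last first.
      by rewrite divr_ge0 ?pi_ge0 ?ltW.
    by congr Num.sqrt; field.
  rewrite /normal_fun -!expRD s2; congr expR; rewrite /mu.
  by field.
under eq_integral do rewrite e EFinM.
rewrite ge0_integralZl_EFin ?expR_ge0//.
- by rewrite integral_normal_pdf mule1.
- by move=> x _; rewrite lee_fin normal_pdf_ge0.
- by apply/measurable_EFinP; exact: measurable_normal_pdf.
Qed.

(** The exponent separates over the coordinates. *)
Lemma integral_gauss2_tuple (R : realType) (d : nat) (k l : R)
    (m n : 'I_d -> R) : 0 <= k -> 0 <= l -> 0 < k + l ->
  (\int[lebesgue_tuple d]_y
     (expR (- (k * (\sum_(i < d) (tnth y i - m i) ^+ 2)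
               + l * (\sum_(i < d) (tnth y i - n i) ^+ 2))))%:E)%E =
  (expR (d%:R / 2 * ln (pi / (k + l))
         - k * l / (k + l) * (\sum_(i < d) (m i - n i) ^+ 2)))%:E.
Proof.
move=> k0 l0 kl0.
pose f i x := expR (- (k * (x - m i) ^+ 2 + l * (x - n i) ^+ 2)).
rewrite (eq_integral (fun y => (\prod_(i < d) f i (tnth y i))%:E)); last first.
  move=> y _; rewrite /f -expR_sum; congr (expR _)%:E.
  by rewrite sumrN big_split/= -!mulr_sumr.
rewrite (integral_lebesgue_tuple_prod (I := fun i =>
  expR (2^-1 * ln (pi / (k + l)) - k * l / (k + l) * (m i - n i) ^+ 2))).
- rewrite -expR_sum; congr (expR _)%:E.
  rewrite big_split/= sumrN; congr (_ - _); last by rewrite mulr_sumr.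
  by rewrite sumr_const card_ord -[LHS]mulr_natl mulrA.
- move=> i; apply: measurableT_comp => //; apply: measurableT_comp => //.
  by apply: measurable_funD; apply: measurable_funM => //;
    apply: measurable_funX; apply: measurable_funB.
- by move=> i x; exact: expR_ge0.
- by move=> i; exact: integral_gauss2.
Qed.

(** Putting the normalising constant in the exponent lets powers and ratios of
    densities be computed on exponents alone. *)
Lemma normal_densityE (R : realType) (d : nat) (m : d.-tuple R) (v : R) y :
  0 < v ->
  normal_density m v y =
  expR (- (d%:R / 2 * ln (2 * pi * v))
        - (2 * v)^-1 * (\sum_(i < d) (tnth y i - tnth m i) ^+ 2)).
Proof.
move=> v0; have p0 : 0 < 2 * pi * v by rewrite !mulr_gt0// pi_gt0.
rewrite /normal_density -{1}(lnK p0) -expRM -expRD; congr expR.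
by field; rewrite gt_eqF.
Qed.

Lemma measurable_sqdist (R : realType) (d : nat) (m : 'I_d -> R) :
  measurable_fun [set: d.-tuple R]
    (fun y : d.-tuple R => \sum_(i < d) (tnth y i - m i) ^+ 2).
Proof.
apply: measurable_sum => i; apply: measurable_funX; apply: measurable_funB => //.
exact: measurable_tnth.
Qed.

Lemma measurable_normal_density (R : realType) (d : nat) (m : d.-tuple R)
    (v : R) : measurable_fun [set: d.-tuple R] (normal_density m v).
Proof.
apply: measurable_funM => //; apply: measurableT_comp => //.
by apply: measurable_funM => //; apply: measurableT_comp => //;
  exact: measurable_sqdist.
Qed.

Lemma normal_density_ge0 (R : realType) (d : nat) (m : d.-tuple R) (v : R) y :
  0 <= normal_density m v y.
Proof. by rewrite mulr_ge0 ?powR_ge0 ?expR_ge0. Qed.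

Lemma integral_normal_density (R : realType) (d : nat) (m : d.-tuple R)
    (v : R) : 0 < v ->
  (\int[lebesgue_tuple d]_y (normal_density m v y)%:E)%E = 1%E.
Proof.
move=> v0.
pose K := expR (- (d%:R / 2 * ln (2 * pi * v))).
(* One kernel is the product of two kernels, the second of precision 0. *)
have e y : normal_density m v y = K * expR (- ((2 * v)^-1 *
    (\sum_(i < d) (tnth y i - tnth m i) ^+ 2) +
    0 * (\sum_(i < d) (tnth y i - tnth m i) ^+ 2))).
  by rewrite normal_densityE// expRD mul0r addr0.
have v20 : 0 < (2 * v)^-1 by rewrite invr_gt0 mulr_gt0.
under eq_integral do rewrite e EFinM.
rewrite ge0_integralZl_EFin ?expR_ge0//; last first.
  apply/measurable_EFinP; apply: measurableT_comp => //.
  by apply: measurableT_comp => //; apply: measurable_funD;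
    apply: measurable_funM => //; exact: measurable_sqdist.
rewrite integral_gauss2_tuple ?addr0 ?(ltW v20)// -EFinM -expRD mulr0 !mul0r subr0.
by rewrite invrK [pi * _]mulrCA mulrA addNr expR0.
Qed.

(** * The alpha-loss of an expanded density *)

(** The geometric mixture p `^ beta * q `^ (1 - beta) of the densities of
    N(m, c ^+ 2 * v I) and N(theta, v I) has precision
    mix_scale alpha c / (c ^+ 2 * v). *)
Definition mix_scale (R : realType) (alpha c : R) : R :=
  (1 + alpha) / 2 + (1 - alpha) / 2 * c ^+ 2.

(** The integral of that geometric mixture. *)
Definition gauss_affinity (R : realType) (d : nat) (alpha v c : R)
    (m theta : 'I_d -> R) : R :=
  expR (d%:R / 2 * ((1 - alpha) * ln c - ln (mix_scale alpha c))
        - (1 - alpha ^+ 2) / 4 / (2 * v * mix_scale alpha c) *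
          \sum_(i < d) (m i - theta i) ^+ 2).

Section alpha_divergence.
Context (R : realType) (d : nat).
Variables (alpha v : R).
Hypotheses (halpha : `|alpha| < 1) (v0 : 0 < v).
Local Notation beta := ((1 + alpha) / 2).

Let alphaP : -1 < alpha < 1.
Proof. by rewrite -ltr_norml. Qed.

Lemma mix_scale_gt0 c : 0 < c -> 0 < mix_scale alpha c.
Proof.
move=> c0; have /andP[a1 a2] := alphaP.
by rewrite /mix_scale; apply: addr_gt0; [lra|apply: mulr_gt0; [lra|exact: exprn_gt0]].
Qed.

(** Up to a constant, the logarithm of the integrand is minus a weighted
    sum of the squared distances from y to m and to theta. *)
Lemma integral_gauss_affinity (c : R) (m theta : d.-tuple R) : 0 < c ->
  (\int[lebesgue_tuple d]_y
     ((normal_density m (c ^+ 2 * v) y / normal_density theta v y) `^ beta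
      * normal_density theta v y)%:E)%E =
  (gauss_affinity alpha v c (tnth m) (tnth theta))%:E.
Proof.
move=> c0; have /andP[a1 a2] := alphaP.
have c20 : 0 < c ^+ 2 by exact: exprn_gt0.
have cv0 : 0 < c ^+ 2 * v by exact: mulr_gt0.
have M0 := mix_scale_gt0 c0.
(* The integrand below is K times a product of two kernels, with precisions
   2 * k around m and 2 * l around theta. *)
pose K := expR (- (d%:R / 2 * (beta * ln (c ^+ 2) + ln (2 * pi * v)))).
pose k := beta / (2 * (c ^+ 2 * v)).
pose l := (1 - beta) / (2 * v).
have b0 : 0 < beta by lra.
have b1 : 0 < 1 - beta by lra.
have k0 : 0 < k by rewrite /k divr_gt0// mulr_gt0.
have l0 : 0 < l by rewrite /l divr_gt0// mulr_gt0.
have klE : k + l = mix_scale alpha c / (2 * (c ^+ 2 * v)).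
  by rewrite /k /l /mix_scale; field; rewrite !gt_eqF.
have pv0 : 0 < 2 * pi * v by rewrite !mulr_gt0// pi_gt0.
have e y : (normal_density m (c ^+ 2 * v) y / normal_density theta v y) `^ beta
      * normal_density theta v y =
    K * expR (- (k * (\sum_(i < d) (tnth y i - tnth m i) ^+ 2) +
                 l * (\sum_(i < d) (tnth y i - tnth theta i) ^+ 2))).
  rewrite !normal_densityE// -expRB -expRM -!expRD; congr expR.
  rewrite [2 * pi * (_ * _)]mulrCA (lnM (x := c ^+ 2)) ?posrE// /k /l.
  by field; rewrite !gt_eqF.
under eq_integral do rewrite e EFinM.
rewrite ge0_integralZl_EFin ?expR_ge0//; last first.
  apply/measurable_EFinP; apply: measurableT_comp => //.
  by apply: measurableT_comp => //; apply: measurable_funD;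
    apply: measurable_funM => //; exact: measurable_sqdist.
rewrite integral_gauss2_tuple ?ltW ?addr_gt0// -EFinM -expRD.
congr (expR _)%:E; rewrite addrA; congr (_ - _ * _); last first.
  by rewrite klE /k /l; field; rewrite !gt_eqF.
have -> : pi / (k + l) = 2 * pi * v * c ^+ 2 / mix_scale alpha c.
  by rewrite klE; field; rewrite !gt_eqF.
rewrite ln_div ?posrE ?mulr_gt0 ?pi_gt0//.
rewrite (lnM (x := 2 * pi * v)) ?posrE// lnXn//.
by field.
Qed.

(** The loss integrand is a multiple of q - p `^ beta * q `^ (1 - beta), a
    difference of two integrable functions. *)
Lemma alpha_loss_normal (c : R) (m theta : d.-tuple R) : 0 < c ->
  alpha_loss alpha (fun theta => normal_density theta v) theta
    (normal_density m (c ^+ 2 * v)) =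
  (4 / (1 - alpha ^+ 2) * (1 - gauss_affinity alpha v c (tnth m) (tnth theta)))%:E.
Proof.
move=> c0; rewrite /alpha_loss /h_alpha.
set C := 4 / _.
have aff := integral_gauss_affinity m theta c0.
pose p y := (normal_density m (c ^+ 2 * v) y / normal_density theta v y) `^ beta
  * normal_density theta v y.
have mp : measurable_fun [set: d.-tuple R] p.
  have mratio : measurable_fun [set: d.-tuple R] (fun y =>
      normal_density m (c ^+ 2 * v) y / normal_density theta v y).
    apply: measurable_funM; first exact: measurable_normal_density.
    have -> : (fun y => (normal_density theta v y)^-1) =
        (fun y => normal_density theta v y `^ (-1)).
      by apply/funext => y; rewrite powR_inv1// normal_density_ge0.
    apply: (measurableT_comp (measurable_powR _)).
    exact: measurable_normal_density.
  apply: measurable_funM; last exact: measurable_normal_density.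
  exact: (measurableT_comp (measurable_powR _)).
have pint : (lebesgue_tuple d).-integrable setT (EFin \o p).
  apply/integrableP; split; first exact/measurable_EFinP.
  have p0 y : 0 <= p y by rewrite mulr_ge0 ?powR_ge0 ?normal_density_ge0.
  under eq_integral do rewrite /= ger0_norm//.
  by rewrite aff ltry.
have qint : (lebesgue_tuple d).-integrable setT (EFin \o normal_density theta v).
  apply/integrableP; split.
    by apply/measurable_EFinP; exact: measurable_normal_density.
  under eq_integral do rewrite /= ger0_norm ?normal_density_ge0//.
  by rewrite integral_normal_density// ltry.
rewrite (eq_integral (fun y => C%:E * ((EFin \o normal_density theta v) \- (EFin \o p)) y)%E); last first.
  move=> y _; rewrite /p /= -EFinB -EFinM; congr EFin.
  by rewrite -mulrA mulrBl mul1r.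
rewrite integralZl//; last exact: integrableB.
by rewrite integralB// integral_normal_density// aff.
Qed.

End alpha_divergence.

(** * The risk of an expanded density *)

(** What mix_scale becomes once the affinity is averaged over the estimate:
    the variance a ^+ 2 * u of a X adds to it a term proportional to u / v. *)
Definition risk_scale (R : realType) (alpha a r c : R) : R :=
  mix_scale alpha c + (1 - alpha ^+ 2) / 4 * (a ^+ 2 * r).

(** The logarithm of the expected affinity under X ~ N(theta, u I). *)
Definition affinity_exponent (R : realType) (d : nat) (alpha a u v c : R)
    (theta : 'I_d -> R) : R :=
  d%:R / 2 * ((1 - alpha) * ln c - ln (risk_scale alpha a (u / v) c))
  - (1 - alpha ^+ 2) / 4 * (1 - a) ^+ 2 / (2 * v * risk_scale alpha a (u / v) c) *
    \sum_(i < d) theta i ^+ 2.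

Section risk_closed_form.
Context (R : realType) (d : nat).
Variables (alpha a u v : R).
Hypotheses (halpha : `|alpha| < 1) (a0 : 0 < a) (u0 : 0 < u) (v0 : 0 < v).

Lemma quarter_onemsqr_gt0 : 0 < (1 - alpha ^+ 2) / 4.
Proof.
move: halpha; rewrite ltr_norml => /andP[a1 a2].
have -> : (1 - alpha ^+ 2) / 4 = (1 - alpha) * (1 + alpha) / 4 by ring.
by rewrite divr_gt0// mulr_gt0//; lra.
Qed.

Lemma risk_scale_gt0 r c : 0 <= r -> 0 < c -> 0 < risk_scale alpha a r c.
Proof.
move=> r0 c0; apply: ltr_wpDr; last exact: mix_scale_gt0.
by rewrite mulr_ge0 ?(ltW quarter_onemsqr_gt0)// mulr_ge0// sqr_ge0.
Qed.

Lemma measurable_gauss_affinity (c : R) (theta : d.-tuple R) :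
  measurable_fun [set: d.-tuple R]
    (fun x => gauss_affinity alpha v c (tnth (scale_tuple a x)) (tnth theta)).
Proof.
apply: measurableT_comp => //; apply: measurable_funB => //.
apply: measurable_funM => //; apply: measurable_sum => i.
apply: measurable_funX; apply: measurable_funB => //.
under eq_fun do rewrite tnth_mktuple.
by apply: measurable_funM => //; exact: measurable_tnth.
Qed.

(** Since a <> 0, |a x - theta|^2 = a^2 |x - theta / a|^2, and the integrand is
    again a product of two Gaussian kernels, centred at theta / a and theta; the
    distance of these centres produces the factor (1 - a) ^+ 2. *)
Lemma integral_affinity_normal (c : R) (theta : d.-tuple R) : 0 < c ->
  (\int[lebesgue_tuple d]_x
     (gauss_affinity alpha v c (tnth (scale_tuple a x)) (tnth theta)
      * normal_density theta u x)%:E)%E =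
  (expR (affinity_exponent alpha a u v c (tnth theta)))%:E.
Proof.
move=> c0.
set M := mix_scale alpha c; set B := risk_scale alpha a (u / v) c.
pose e := (1 - alpha ^+ 2) / 4.
have e0 : 0 < e := quarter_onemsqr_gt0.
have M0 : 0 < M by exact: mix_scale_gt0.
have r0 : 0 < u / v by exact: divr_gt0.
have B0 : 0 < B by apply: risk_scale_gt0 => //; exact: ltW.
have a20 : 0 < a ^+ 2 by exact: exprn_gt0.
have pu0 : 0 < 2 * pi * u by rewrite !mulr_gt0// pi_gt0.
pose k := e / (2 * v * M) * a ^+ 2.
pose l := (2 * u)^-1.
have k0 : 0 < k by rewrite mulr_gt0// divr_gt0// !mulr_gt0.
have l0 : 0 < l by rewrite invr_gt0 mulr_gt0.
have klE : k + l = B / (2 * u * M).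
  rewrite /k /l /B /risk_scale -/M -/e; field; by rewrite !gt_eqF.
(* K collects the terms of the exponent that do not depend on x. *)
pose K := expR (d%:R / 2 * ((1 - alpha) * ln c - ln M - ln (2 * pi * u))).
have E x : gauss_affinity alpha v c (tnth (scale_tuple a x)) (tnth theta)
      * normal_density theta u x =
    K * expR (- (k * (\sum_(i < d) (tnth x i - tnth theta i / a) ^+ 2) +
                 l * (\sum_(i < d) (tnth x i - tnth theta i) ^+ 2))).
  rewrite normal_densityE// /gauss_affinity -!expRD; congr expR.
  have -> : \sum_(i < d) (tnth (scale_tuple a x) i - tnth theta i) ^+ 2 =
      a ^+ 2 * \sum_(i < d) (tnth x i - tnth theta i / a) ^+ 2.
    rewrite mulr_sumr; apply: eq_bigr => i _; rewrite tnth_mktuple.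
    by field; rewrite gt_eqF.
  rewrite -/M /k /l /e.
  by field; rewrite !gt_eqF.
under eq_integral do rewrite E EFinM.
rewrite ge0_integralZl_EFin ?expR_ge0//; last first.
  apply/measurable_EFinP; apply: measurableT_comp => //.
  by apply: measurableT_comp => //; apply: measurable_funD;
    apply: measurable_funM => //; exact: measurable_sqdist.
rewrite (integral_gauss2_tuple (fun i => tnth theta i / a)) ?ltW ?addr_gt0//.
rewrite -EFinM -expRD; congr (expR _)%:E.
have -> : \sum_(i < d) (tnth theta i / a - tnth theta i) ^+ 2 =
    ((1 - a) / a) ^+ 2 * \sum_(i < d) tnth theta i ^+ 2.
  rewrite mulr_sumr; apply: eq_bigr => i _.
  by field; rewrite gt_eqF.
rewrite /affinity_exponent -/B -/e.
have -> : pi / (k + l) = 2 * pi * u * M / B.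
  by rewrite klE; field; rewrite !gt_eqF.
rewrite ln_div ?posrE ?(mulr_gt0 pu0)// (lnM (x := 2 * pi * u)) ?posrE//.
rewrite klE /k /l /e.
by field; rewrite !gt_eqF.
Qed.

Lemma expected_alpha_loss (disp : measure_display) (Omega : measurableType disp)
    (P : probability Omega R) (X : {mfun Omega >-> d.-tuple R})
    (theta : d.-tuple R) (c : R) :
  (forall A, measurable A -> distribution P X A = normal_law theta u A) ->
  0 < c ->
  (\int[P]_w alpha_loss alpha (fun theta => normal_density theta v) theta
     (normal_density (scale_tuple a (X w)) (c ^+ 2 * v)))%E =
  (4 / (1 - alpha ^+ 2) * (1 - expR (affinity_exponent alpha a u v c (tnth theta))))%:E.
Proof.
move=> PX c0.
under eq_integral do rewrite (alpha_loss_normal halpha v0 _ _ c0).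
set C := 4 / _.
pose g x := gauss_affinity alpha v c (tnth (scale_tuple a x)) (tnth theta).
have mg : measurable_fun [set: d.-tuple R] g by exact: measurable_gauss_affinity.
have mgX : measurable_fun [set: Omega] (g \o X) by exact: measurableT_comp.
have gX : (\int[P]_w ((g \o X) w)%:E)%E =
    (expR (affinity_exponent alpha a u v c (tnth theta)))%:E.
  rewrite -(integral_affinity_normal _ c0).
  rewrite -(@ge0_integral_density _ _ _ (distribution P X) (lebesgue_tuple d)
    (normal_density theta u))//.
  - rewrite ge0_integral_distribution//; first exact/measurable_EFinP.
    by move=> x; rewrite lee_fin expR_ge0.
  - exact: measurable_normal_density.
  - by move=> x; exact: normal_density_ge0.
  - by move=> x; exact: expR_ge0.
have gint : P.-integrable setT (EFin \o (g \o X)).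
  apply/integrableP; split; first exact/measurable_EFinP.
  under eq_integral do rewrite /= ger0_norm ?expR_ge0//.
  by rewrite gX ltry.
have cint : P.-integrable setT (cst 1%E : Omega -> \bar R).
  exact: finite_measure_integrable_cst.
rewrite (eq_integral (fun w => C%:E * (cst 1%E \- (EFin \o (g \o X))) w)%E); last first.
  by move=> w _; rewrite /= -EFinB -EFinM.
rewrite integralZl//; last exact: integrableB.
by rewrite integralB// gX integral_cst// [X in (1 * X)%E]probability_setT mul1e.
Qed.

End risk_closed_form.

(** * The equation for the maximal expansion *)

(** f decreases on [0, s] and increases on [s, +oo[, where s is the zero of f';
    hence f is negative from 0 until its single zero k > s, and positive
    afterwards. *)
Lemma expR_trinomial_sign (R : realType) (A K M p q : R) :
  0 < A -> 0 < M -> 0 < p -> p < q -> A - K + M = 0 -> q * A < p * K ->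
  let f t := A * expR (q * t) - K * expR (p * t) + M in
  exists2 k, 0 < k &
    [/\ f k = 0, forall t, 0 < t < k -> f t < 0 & forall t, k < t -> 0 < f t].
Proof.
move=> A0 M0 p0 pq AKM qApK f.
have q0 : 0 < q by exact: lt_trans pq.
have qp0 : 0 < q - p by rewrite subr_gt0.
have K0 : 0 < K by lra.
have f0 : f 0 = 0 by rewrite /f !mulr0 expR0 !mulr1.
pose s := ln (p * K / (q * A)) / (q - p).
(* At T the two exponential terms cancel, so that f T = M. *)
pose T := ln (K / A) / (q - p).
have qA0 : 0 < q * A by exact: mulr_gt0.
have KA0 : 0 < K / A by exact: divr_gt0.
have pKqA0 : 0 < p * K / (q * A) by rewrite divr_gt0// mulr_gt0.
have s0 : 0 < s by rewrite divr_gt0// ln_gt0// ltr_pdivlMr// mul1r.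
have sT : s < T.
  rewrite ltr_pM2r ?invr_gt0// ltr_ln ?posrE//.
  rewrite ltr_pdivrMr//.
  have -> : K / A * (q * A) = q * K by field; rewrite gt_eqF.
  by rewrite ltr_pM2r.
have fE t : f t = expR (p * t) * (A * expR ((q - p) * t) - K) + M.
  rewrite /f mulrBr [expR _ * (A * _)]mulrCA -expRD -mulrDl.
  by rewrite [p + _]addrC subrK [expR _ * K]mulrC.
have fT : 0 < f T.
  have TE : (q - p) * T = ln (K / A) by rewrite mulrC divfK ?gt_eqF.
  by rewrite fE TE lnK// [A * _]mulrC divfK ?gt_eqF// subrr mulr0 add0r.
pose df t := expR (p * t) * (q * A * expR ((q - p) * t) - p * K).
have df_is (t : R) : is_derive t 1 f (df t).
  rewrite /f; apply: is_derive_eq.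
  rewrite /df /GRing.scale/=.
  have -> : expR (q * t) = expR (p * t) * expR ((q - p) * t).
    by rewrite -expRD; congr expR; ring.
  ring.
have fcont : continuous f.
  move=> t; apply: differentiable_continuous.
  by apply/derivable1_diffP; have [] := df_is t.
have fwith (i : interval R) : {within [set` i], continuous f}.
  exact: continuous_subspaceT.
have fder (t : R) : derivable f t 1 by have [] := df_is t.
have f'E t : derive1 f t = df t by rewrite derive1E; have [_ ->] := df_is t.
have sE : q * A * expR ((q - p) * s) = p * K.
  have -> : (q - p) * s = ln (p * K / (q * A)) by rewrite mulrC divfK ?gt_eqF.
  by rewrite lnK// mulrC divfK ?gt_eqF.
have df_lt t : t < s -> df t < 0.
  move=> ts; rewrite pmulr_rlt0 ?expR_gt0// subr_lt0 -sE ltr_pM2l//.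
  by rewrite ltr_expR ltr_pM2l.
have df_gt t : s < t -> 0 < df t.
  move=> ts; rewrite mulr_gt0 ?expR_gt0// subr_gt0 -sE ltr_pM2l//.
  by rewrite ltr_expR ltr_pM2l.
have decr x y : 0 <= x -> x < y -> y <= s -> f y < f x.
  apply: (@ltr0_derive1_decr _ f 0 s) => // t; rewrite in_itv/= => /andP[_ ts].
  by rewrite f'E df_lt.
have incr x y : s <= x -> x < y -> f x < f y.
  move=> sx xy; apply: (@gtr0_derive1_incr _ f s y) => // t.
  by rewrite in_itv/= => /andP[st _]; rewrite f'E df_gt.
have fs : f s < 0 by rewrite -f0 decr.
have [k] : exists2 k, k \in `[s, T] & f k = 0.
  apply: IVT => //; first exact: ltW.
  by rewrite ge_min le_max (ltW fs) (ltW fT) orbT.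
rewrite in_itv/= => /andP[sk _] fk.
exists k; first exact: lt_le_trans sk.
split=> // [t /andP[t0 tk]|t kt]; last by rewrite -fk incr.
have [ts|st] := leP t s; first by rewrite -f0 decr.
by rewrite -fk incr// ltW.
Qed.

(** Named because its sign matters, not only its zeros; expansion_equation
    unfolds to its vanishing. *)
Definition expansion_lhs (R : realType) (alpha a r c : R) : R :=
  2 * (1 - alpha) * c ^+ 2
    - (4 + (1 - alpha ^+ 2) * a ^+ 2 * r) * c `^ (1 - alpha)
    + (1 + alpha) * (2 + (1 - alpha) * a ^+ 2 * r).

(** In the variable t = ln c, the left-hand side is the combination of
    exponentials above, with q = 2 and p = 1 - alpha. *)
Lemma expansion_lhs_sign (R : realType) (alpha a r : R) :
  `|alpha| < 1 -> 0 < a -> 0 < r ->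
  exists2 k, 1 < k & [/\ expansion_lhs alpha a r k = 0,
    forall c, 1 < c < k -> expansion_lhs alpha a r c < 0 &
    forall c, k < c -> 0 < expansion_lhs alpha a r c].
Proof.
move=> halpha a0 r0.
have := halpha; rewrite ltr_norml => /andP[a1 a2].
have e0 := quarter_onemsqr_gt0 halpha.
have ar0 : 0 < a ^+ 2 * r by rewrite mulr_gt0// exprn_gt0.
have ear0 : 0 < (1 - alpha ^+ 2) * (a ^+ 2 * r) by rewrite mulr_gt0//; lra.
have p0 : 0 < 1 - alpha by lra.
have [||||||k k0 [fk flt fgt]] := @expR_trinomial_sign R (2 * (1 - alpha))
  (4 + (1 - alpha ^+ 2) * a ^+ 2 * r) ((1 + alpha) * (2 + (1 - alpha) * a ^+ 2 * r))
  (1 - alpha) 2.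
- by rewrite mulr_gt0.
- by rewrite mulr_gt0//; [lra|rewrite addr_gt0// -mulrA mulr_gt0].
- by [].
- by lra.
- by ring.
- rewrite -subr_gt0.
  rewrite (_ : _ - _ = (1 - alpha) * ((1 - alpha ^+ 2) * (a ^+ 2 * r))).
    exact: mulr_gt0.
  ring.
have fE c : 0 < c -> expansion_lhs alpha a r c =
    2 * (1 - alpha) * expR (2 * ln c) -
    (4 + (1 - alpha ^+ 2) * a ^+ 2 * r) * expR ((1 - alpha) * ln c) +
    (1 + alpha) * (2 + (1 - alpha) * a ^+ 2 * r).
  move=> c0; rewrite /expansion_lhs -{1 2}[c]lnK ?posrE// -expRM_natl.
  by rewrite -expRM [ln c * _]mulrC.
exists (expR k); first by rewrite expR_gt1.
split=> [|c /andP[c1 ck]|c kc].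
- by rewrite fE ?expR_gt0// expRK.
- have c0 : 0 < c by exact: lt_trans c1.
  by rewrite fE// flt// ln_gt0//= -ltr_expR lnK.
- have c0 : 0 < c by apply: lt_trans kc; exact: expR_gt0.
  by rewrite fE// fgt// -ltr_expR lnK.
Qed.

(** Links the equation for k with the two risks at theta = 0. *)
Lemma expansion_lhsE (R : realType) (alpha a r c : R) :
  expansion_lhs alpha a r c =
  4 * (risk_scale alpha a r c - risk_scale alpha a r 1 * c `^ (1 - alpha)).
Proof. by rewrite /expansion_lhs /risk_scale /mix_scale; field. Qed.

Lemma risk_scale_lt (R : realType) (alpha a r c : R) : `|alpha| < 1 -> 1 < c ->
  risk_scale alpha a r 1 < risk_scale alpha a r c.
Proof.
rewrite ltr_norml => /andP[_ a1] c1; rewrite /risk_scale /mix_scale.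
rewrite ltrD2r ltrD2l ltr_pM2l ?divr_gt0 ?subr_gt0//.
by rewrite expr1n exprn_egt1.
Qed.

Lemma expansion_lhs_le0 (R : realType) (alpha a r c : R) :
  `|alpha| < 1 -> 0 <= r -> 0 < c ->
  (expansion_lhs alpha a r c <= 0) =
  (- ln (risk_scale alpha a r 1) <=
   (1 - alpha) * ln c - ln (risk_scale alpha a r c)).
Proof.
move=> halpha r0 c0; rewrite expansion_lhsE pmulr_rle0// subr_le0.
have B1 : 0 < risk_scale alpha a r 1 by exact: risk_scale_gt0.
have Bc : 0 < risk_scale alpha a r c by exact: risk_scale_gt0.
have cp0 : 0 < c `^ (1 - alpha) by exact: powR_gt0.
rewrite -ler_ln ?posrE ?mulr_gt0// lnM ?posrE// ln_powR.
by rewrite -subr_ge0 -[RHS]subr_ge0; congr (0 <= _); ring.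
Qed.

(** * Domination *)

Theorem theorem1 (R : realType) (d : nat) (hd : (0 < d)%N)
    (sigmaX sigmaY : R) (hsX : 0 < sigmaX) (hsY : 0 < sigmaY)
    (dO : measure_display) (Omega : measurableType dO)
    (P : d.-tuple R -> probability Omega R)
    (X Y : {mfun Omega >-> d.-tuple R})
    (hX : forall (theta : d.-tuple R) (A : set (d.-tuple R)), measurable A ->
      distribution (P theta) X A = normal_law theta (sigmaX ^+ 2) A)
    (hY : forall (theta : d.-tuple R) (A : set (d.-tuple R)), measurable A ->
      distribution (P theta) Y A = normal_law theta (sigmaY ^+ 2) A)
    (hXY : forall theta : d.-tuple R, independent_rv (P theta) X Y)
    (alpha a r : R) (halpha : `|alpha| < 1) (ha0 : 0 < a) (ha1 : a < 1)
    (hr : r = sigmaX ^+ 2 / sigmaY ^+ 2) :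
  (exists! k : R, 1 < k /\ expansion_equation alpha a r k) /\
  (forall k : R, 1 < k -> expansion_equation alpha a r k ->
   forall c : R, 1 <= c ->
     (dominates_on [set: d.-tuple R]
        (alpha_risk P X alpha (fun theta => normal_density theta (sigmaY ^+ 2)))
        (expanded_density a sigmaY c) (expanded_density a sigmaY 1)
      <-> 1 < c ^+ 2 /\ c ^+ 2 <= k ^+ 2)).
Proof.
have u0 : 0 < sigmaX ^+ 2 by exact: exprn_gt0.
have v0 : 0 < sigmaY ^+ 2 by exact: exprn_gt0.
have r0 : 0 < r by rewrite hr divr_gt0.
have [k k1 [Ek Elt Egt]] := expansion_lhs_sign halpha ha0 r0.
have k_uniq k' : 1 < k' -> expansion_equation alpha a r k' -> k' = k.
  move=> k'1 Ek'; apply/eqP; rewrite eq_le !leNgt; apply/andP; split.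
    by apply/negP => /Egt; rewrite [expansion_lhs _ _ _ _]Ek' ltxx.
  apply/negP => k'k; have /Elt : 1 < k' < k by rewrite k'1.
  by rewrite [expansion_lhs _ _ _ _]Ek' ltxx.
split.
  by exists k; split=> [//|k' [k'1 /(k_uniq _ k'1)]].
move=> k' k'1 /(k_uniq _ k'1) -> c c1.
have c0 : 0 < c by exact: lt_le_trans c1.
have k0 : 0 < k by exact: lt_trans k1.
pose g c (theta : d.-tuple R) :=
  affinity_exponent alpha a (sigmaX ^+ 2) (sigmaY ^+ 2) c (tnth theta).
pose risk := alpha_risk P X alpha (fun theta => normal_density theta (sigmaY ^+ 2)).
pose C := 4 / (1 - alpha ^+ 2).
have e0 := quarter_onemsqr_gt0 halpha.
have C0 : 0 < C by rewrite divr_gt0//; lra.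
have riskE x theta : 0 < x ->
    risk theta (expanded_density a sigmaY x) = (C * (1 - expR (g x theta)))%:E.
  by move=> x0; apply: expected_alpha_loss => // A; exact: hX.
have risk_le theta : (risk theta (expanded_density a sigmaY c) <=
    risk theta (expanded_density a sigmaY 1))%E = (g 1 theta <= g c theta).
  by rewrite !riskE// lee_fin ler_pM2l// lerD2l lerN2 ler_expR.
have risk_lt theta : (risk theta (expanded_density a sigmaY c) <
    risk theta (expanded_density a sigmaY 1))%E = (g 1 theta < g c theta).
  by rewrite !riskE// lte_fin ltr_pM2l// ltrD2l ltrN2 ltr_expR.
pose B := risk_scale alpha a r.
have Bgt0 x : 0 < x -> 0 < B x.
  by move=> x0; apply: risk_scale_gt0 => //; exact: ltW.
pose kappa := (1 - alpha ^+ 2) / 4 * (1 - a) ^+ 2.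
have kappa0 : 0 < kappa by rewrite mulr_gt0// exprn_gt0// subr_gt0.
have gE x theta : g x theta = d%:R / 2 * ((1 - alpha) * ln x - ln (B x)) -
    kappa / (2 * sigmaY ^+ 2 * B x) * \sum_(i < d) tnth theta i ^+ 2.
  by rewrite /g /affinity_exponent -hr.
have d20 : 0 < d%:R / 2 :> R by rewrite divr_gt0// ltr0n.
have lead_le : (d%:R / 2 * ((1 - alpha) * ln 1 - ln (B 1)) <=
    d%:R / 2 * ((1 - alpha) * ln c - ln (B c))) =
    (expansion_lhs alpha a r c <= 0).
  by rewrite expansion_lhs_le0 ?(ltW r0)// ler_pM2l// ln1 mulr0 sub0r.
split=> [[dom_le [theta1 _]]|[c21 ck]].
  rewrite risk_lt => g_lt.
  have {}c1 : 1 < c.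
    by rewrite lt_neqAle c1 andbT; apply: contraTneq g_lt => <-; rewrite ltxx.
  split; first by rewrite exprn_egt1.
  (* At theta = 0 only the leading terms of the exponents remain. *)
  rewrite ler_pXn2r ?nnegrE ?(ltW c0) ?(ltW k0)// leNgt; apply/negP => /Egt.
  rewrite ltNge -lead_le.
  have := dom_le [tuple 0 | i < d] I; rewrite -/risk risk_le !gE.
  rewrite big1 => [|i _]; last by rewrite tnth_mktuple expr0n.
  by rewrite !mulr0 !subr0 => ->.
have {}c1 : 1 < c.
  by rewrite lt_neqAle c1 andbT; apply: contraTneq c21 => <-; rewrite expr1n ltxx.
have {}ck : c <= k.
  by move: ck; rewrite ler_pXn2r// nnegrE ltW.
have Ec : expansion_lhs alpha a r c <= 0.
  move: ck; rewrite le_eqVlt => /predU1P[->|ck]; first by rewrite Ek.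
  by apply/ltW/Elt; rewrite c1.
have B1c : B 1 < B c by exact: risk_scale_lt.
have damp : kappa / (2 * sigmaY ^+ 2 * B c) < kappa / (2 * sigmaY ^+ 2 * B 1).
  rewrite ltr_pM2l// ltf_pV2 ?posrE ?mulr_gt0 ?Bgt0//.
  by rewrite ltr_pM2l// mulr_gt0.
split=> [theta _|].
  rewrite -/risk risk_le !gE; apply: lerB; first by rewrite lead_le.
  rewrite ler_wpM2r ?(ltW damp)//.
  by apply: sumr_ge0 => i _; exact: sqr_ge0.
(* Any theta <> 0 makes the gain strict. *)
exists [tuple 1 | i < d] => //; rewrite -/risk risk_lt !gE.
apply: ler_ltB; first by rewrite lead_le.
rewrite ltr_pM2r//.
under eq_bigr do rewrite tnth_mktuple expr1n.
by rewrite sumr_const card_ord ltr0n.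
Qed.
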